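(* Consider the fixed-design linear model with privileged information described in the context. Assume that $X^\top X$ is invertible, and that $A^\top A$ and $[X,A]^\top[X,A]$ are almost surely invertible. Then $$\mathbb{E}[\mathcal{R}(\tau_{\text{NO-PI}}(X))] > \mathbb{E}[\mathcal{R}(\tau_{\text{PI}}(X))]$$ if and only if $$\frac1n\|(I-\Pi_x)\mu(X)v^\star\|^2+\frac{\sigma^2 d}{n}+\frac1n\mathrm{tr}(\Pi_x\Lambda) > \frac{\sigma^2}{n}\,\mathbb{E}[\|K\|^2],$$ where $K = XH_{a\perp}+\mu(X)G_{x\perp}$. Moreover, when $m=1$ (so that $A$ is a column vector), a sufficient condition for $\mathbb{E}[\mathcal{R}(\tau_{\text{NO-PI}}(X))] > \mathbb{E}[\mathcal{R}(\tau_{\text{PI}}(X))]$ is $$\frac1n\|(I-\Pi_x)\mu(X)v^\star\|^2+\frac1n\mathrm{tr}(\Pi_x\Lambda) > \frac{2\sigma^2}{n}\,\mathbb{E}\left[\frac{\|\Pi_xA\|^2+\|\mu(X)\|^2}{\|(I-\Pi_x)A\|^2}\right]+\frac{\sigma^2 d}{n}.$$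
   Context: Model. Fix $n,d,m\ge 1$, $\sigma>0$, parameters $w^\star\in\mathbb{R}^d$, $v^\star\in\mathbb{R}^m$, a mean function $\mu:\mathbb{R}^d\to\mathbb{R}^m$ and a covariance function $\Sigma$ mapping $\mathbb{R}^d$ to symmetric positive semidefinite $m\times m$ matrices. The design is fixed: $X\in\mathbb{R}^{n\times d}$ is deterministic with rows $x_1^\top,\dots,x_n^\top$, and $\mu(X)\in\mathbb{R}^{n\times m}$ has rows $\mu(x_i)^\top$. The random matrix $A\in\mathbb{R}^{n\times m}$ (privileged information, PI) has independent rows $a_i^\top$ with $a_i\sim\mathcal{N}(\mu(x_i),\Sigma(x_i))$; the noise $\varepsilon\sim\mathcal{N}(0,\sigma^2 I_n)$ is independent of $A$; and the training targets are $y=Xw^\star+Av^\star+\varepsilon\in\mathbb{R}^n$. Notation. $\|\cdot\|$ is the Euclidean norm for vectors and the Frobenius norm for matrices, $\|M\|^2=\mathrm{tr}(M^\top M)$. - $\Lambda=\mathrm{Diag}(\{(v^\star)^\top\Sigma(x_i)v^\star\}_{i=1}^n)\in\mathbb{R}^{n\times n}$. - $\Pi_x=X(X^\top X)^{-1}X^\top$ and $\Pi_a=A(A^\top A)^{-1}A^\top$. - $X_{a\perp}=(I-\Pi_a)X$ and $A_{x\perp}=(I-\Pi_x)A$. - $H_{a\perp}=(X_{a\perp}^\top X_{a\perp})^{-1}X_{a\perp}^\top\in\mathbb{R}^{d\times n}$ and $G_{x\perp}=(A_{x\perp}^\top A_{x\perp})^{-1}A_{x\perp}^\top\in\mathbb{R}^{m\times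 n}$. Risk. For a predictor $\tau(X)\in\mathbb{R}^n$ built from the training quantities $(X,A,\varepsilon)$, let $y'=Xw^\star+A'v^\star+\varepsilon'$, where $(A',\varepsilon')$ is an independent copy of $(A,\varepsilon)$ (same $X$), and define $$\mathcal{R}(\tau(X))=\mathbb{E}_{A',\varepsilon'}\Big[\tfrac1n\|y'-\tau(X)\|^2\Big].$$ $\mathbb{E}[\mathcal{R}(\tau(X))]\in[0,\infty]$ denotes the further expectation over the training quantities $(A,\varepsilon)$; unsubscripted $\mathbb{E}$ is the expectation over the training quantities. Predictors. - $\tau_{\text{NO-PI}}(X)=X\hat w_0$, where $\hat w_0=(X^\top X)^{-1}X^\top y$ is the ordinary least-squares estimate ignoring $A$. - $\tau_{\text{PI}}(X)=X\hat w_1+\mu(X)\hat v_1$, where $(\hat w_1,\hat v_1)$ is the minimizer of $\frac12\|y-Xw-Av\|^2$ over $(w,v)\in\mathbb{R}^d\times\mathbb{R}^m$ (joint least squares on training data, with $A$ replaced by its known mean $\mu(X)$ at prediction time). *)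

(* Defs.v *)
From HB Require Import structures.
From mathcomp Require Import all_boot all_order all_algebra.
From mathcomp Require Import all_classical all_reals all_analysis.

Set Implicit Arguments.
Unset Strict Implicit.
Unset Printing Implicit Defensive.

Import Order.TTheory GRing.Theory Num.Theory.
Import numFieldNormedType.Exports.

Local Open Scope classical_set_scope.
Local Open Scope ring_scope.

Definition sqnorm (R : realType) (p q : nat) (M : 'M[R]_(p, q)) : R :=
  \tr (M^T *m M).

Definition sym_psd (R : realType) (p : nat) (S : 'M[R]_p) : Prop :=
  S^T = S /\ forall z : 'cV[R]_p, 0 <= (z^T *m S *m z) 0 0.

(* [invmx] is the genuine inverse only on invertible matrices; in the theorem
   every Gram matrix below is invertible, at least almost surely. *)
Definition lpinv (R : realType) (p q : nat) (M : 'M[R]_(p, q)) : 'M[R]_(q, p) :=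
  invmx (M^T *m M) *m M^T.

Definition oproj (R : realType) (p q : nat) (M : 'M[R]_(p, q)) : 'M[R]_p :=
  M *m invmx (M^T *m M) *m M^T.

(* [oresid N M] is $M_{N\perp} = (I - \Pi_N) M$. *)
Definition oresid (R : realType) (p q r : nat)
    (N : 'M[R]_(p, q)) (M : 'M[R]_(p, r)) : 'M[R]_(p, r) :=
  (1%:M - oproj N) *m M.

(* One-dimensional $N(a, s)$ with variance [s]. The library's [normal_prob]
   takes a standard deviation, and is the uniform law on [0, 1] when that is 0,
   whence the separate point-mass case. *)
Definition gauss_law (R : realType) (a s : R) (B : set R) : \bar R :=
  if s == 0 then \d_a B else normal_prob a (Num.sqrt s) B.

(* $Z \sim N(a, S)$: every linear functional $t^\top Z$ has law
   $N(t^\top a, t^\top S t)$. [S] may be singular. *)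
Definition gaussian_vector (disp : measure_display) (T : measurableType disp)
    (R : realType) (P : probability T R) (k : nat)
    (Z : T -> 'cV[R]_k) (a : 'cV[R]_k) (S : 'M[R]_k) : Prop :=
  (forall i : 'I_k, measurable_fun [set: T] (fun w => Z w i 0)) /\
  forall (t : 'cV[R]_k) (B : set R), measurable B ->
    P ((fun w => (t^T *m Z w) 0 0) @^-1` B) =
    gauss_law ((t^T *m a) 0 0) ((t^T *m S *m t) 0 0) B.

(* The sigma-algebra on [T] generated by the entries of a random matrix. *)
Definition sigma_mx (disp : measure_display) (T : measurableType disp)
    (R : realType) (p q : nat) (Z : T -> 'M[R]_(p, q)) : set (set T) :=
  <<s \bigcup_(ij in [set: 'I_p * 'I_q])
        preimage_set_system setT (fun w => Z w ij.1 ij.2) measurable >>.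

Definition independent2 (disp : measure_display) (T : measurableType disp)
    (R : realType) (P : probability T R) (F G : set (set T)) : Prop :=
  forall E E' : set T, F E -> G E' -> P (E `&` E') = (P E * P E')%E.

Definition mutually_independent (disp : measure_display)
    (T : measurableType disp) (R : realType) (P : probability T R)
    (I : finType) (F : I -> set (set T)) : Prop :=
  forall (J : {set I}) (E : I -> set T),
    (forall i, i \in J -> F i (E i)) ->
    P (\bigcap_(i in [set i | i \in J]) E i) = (\prod_(i in J) P (E i))%E.

Section Model.
Context (disp : measure_display) (T : measurableType disp) (R : realType).
Context (P : probability T R) (n d m : nat).
Context (X : 'M[R]_(n, d)) (mu : 'cV[R]_d -> 'cV[R]_m).
Context (Sigma : 'cV[R]_d -> 'M[R]_m) (sigma : R).
Context (wstar : 'cV[R]_d) (vstar : 'cV[R]_m).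

Definition design_pt (i : 'I_n) : 'cV[R]_d := (row i X)^T.

Definition mu_mx : 'M[R]_(n, m) := \matrix_(i < n, j < m) mu (design_pt i) j 0.

Definition Lambda_mx : 'M[R]_n :=
  diag_mx (\row_(i < n) (vstar^T *m Sigma (design_pt i) *m vstar) 0 0).

Definition pi_model (A : T -> 'M[R]_(n, m)) (eps : T -> 'cV[R]_n) : Prop :=
  [/\ forall i : 'I_n, gaussian_vector P (fun w => (row i (A w))^T)
        (mu (design_pt i)) (Sigma (design_pt i)),
      mutually_independent P (fun i : 'I_n => sigma_mx (fun w => row i (A w))),
      gaussian_vector P eps 0 ((sigma ^+ 2)%:M) &
      independent2 P (sigma_mx A) (sigma_mx eps)].

Definition target (A : T -> 'M[R]_(n, m)) (eps : T -> 'cV[R]_n) (w : T) :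
    'cV[R]_n :=
  X *m wstar + A w *m vstar + eps w.

(* The training quantities live on one copy of [(T, P)] and the independent
   copy $(A', \varepsilon')$ is [(A, eps)] evaluated on a second one, so that
   $E_{A',\varepsilon'}$ integrates the second sample point [w'] only, the
   value [t] of the predictor being held fixed. *)
Definition risk (A : T -> 'M[R]_(n, m)) (eps : T -> 'cV[R]_n)
    (t : 'cV[R]_n) : \bar R :=
  'E_P[fun w' => n%:R^-1 * sqnorm (target A eps w' - t)].

Definition expected_risk (A : T -> 'M[R]_(n, m)) (eps : T -> 'cV[R]_n)
    (tau : T -> 'cV[R]_n) : \bar R :=
  (\int[P]_w risk A eps (tau w))%E.

Definition tau_nopi (y : 'cV[R]_n) : 'cV[R]_n :=
  X *m (invmx (X^T *m X) *m X^T *m y).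

Definition ls_objective (A : 'M[R]_(n, m)) (y : 'cV[R]_n)
    (b : 'cV[R]_d * 'cV[R]_m) : R :=
  2^-1 * sqnorm (y - X *m b.1 - A *m b.2).

(* The minimizer, i.e. the unique one; [(0, 0)] when the minimizer is not
   unique, that is when $[X, A]^\top [X, A]$ is singular. *)
Definition ls_minimizer (A : 'M[R]_(n, m)) (y : 'cV[R]_n) :
    'cV[R]_d * 'cV[R]_m :=
  xget (0, 0) [set b | forall b', b' <> b ->
                         ls_objective A y b < ls_objective A y b'].

Definition tau_pi (A : 'M[R]_(n, m)) (y : 'cV[R]_n) : 'cV[R]_n :=
  X *m (ls_minimizer A y).1 + mu_mx *m (ls_minimizer A y).2.

Definition K_mx (A : 'M[R]_(n, m)) : 'M[R]_n :=
  X *m lpinv (oresid A X) + mu_mx *m lpinv (oresid X A).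

End Model.

(* Main.v *)
Require Import Defs.
From HB Require Import structures.
From mathcomp Require Import all_boot all_order all_algebra.
From mathcomp Require Import all_classical all_reals all_analysis.
From mathcomp Require Import measurable_realfun.
From mathcomp Require Import ring lra.

Set Implicit Arguments.
Unset Strict Implicit.
Unset Printing Implicit Defensive.

Import Order.TTheory GRing.Theory Num.Theory.
Import numFieldNormedType.Exports.

Local Open Scope classical_set_scope.
Local Open Scope ring_scope.

(* The predictors depend linearly on the centred noise.  With
   z = (A - mu(X)) v* + eps, of mean 0 and covariance S = Lambda + sigma^2 I,
   the OLS prediction is X w* + Pi_x mu(X) v* + Pi_x z, and the joint
   least-squares solution is (w* + H eps, v* + G eps), so that the PI prediction
   is X w* + mu(X) v* + K eps.  Since E |c + M z|^2 = |c|^2 + tr (M S M^T), both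
   expected risks contain the term tr(S)/n; what remains is
   |(I - Pi_x) mu(X) v*|^2 + tr(Pi_x Lambda) + sigma^2 d for OLS, and
   sigma^2 E |K|^2 for PI, by Tonelli's theorem and independence of A and eps.
   When m = 1, K = Pi_x - (Pi_x A - mu(X)) G with G Pi_x = 0, hence
   |K|^2 = d + |Pi_x A - mu(X)|^2 / |(I - Pi_x) A|^2. *)

(** * Means of integrable random variables *)

Section HasMean.
Context (disp : measure_display) (T : measurableType disp) (R : realType).
Implicit Types (P : probability T R) (f g : T -> R).

(** Integrability is bundled with the value of the integral, so that means add and scale without
    side conditions. *)
Definition has_mean P f (a : R) :=
  P.-integrable setT (EFin \o f) /\ (\int[P]_w (f w)%:E = a%:E)%E.

Lemma has_mean_measurable P f a : has_mean P f a -> measurable_fun setT f.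
Proof. by case=> /measurable_int /measurable_EFinP. Qed.

Lemma eq_has_mean P f g a b : f =1 g -> a = b -> has_mean P f a -> has_mean P g b.
Proof. by move=> /funext -> ->. Qed.

Lemma has_mean_cst P a : has_mean P (fun=> a) a.
Proof.
split; first exact: finite_measure_integrable_cst.
by rewrite integral_cst//= probability_setT mule1.
Qed.

Lemma has_meanD P f g a b :
  has_mean P f a -> has_mean P g b -> has_mean P (fun w => f w + g w) (a + b).
Proof.
move=> [If Ef] [Ig Eg]; split.
  by have := integrableD measurableT If Ig; apply: eq_integrable.
under eq_integral do rewrite EFinD.
by rewrite integralD// Ef Eg.
Qed.

Lemma has_meanZ P k f a : has_mean P f a -> has_mean P (fun w => k * f w) (k * a).
Proof.
move=> [If Ef]; split.
  by have := integrableZl measurableT k If; apply: eq_integrable.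
under eq_integral do rewrite EFinM.
by rewrite integralZl// Ef.
Qed.

Lemma has_meanB P f g a b :
  has_mean P f a -> has_mean P g b -> has_mean P (fun w => f w - g w) (a - b).
Proof.
move=> hf /(has_meanZ (-1)) hg; apply: eq_has_mean (has_meanD hf hg).
  by move=> w /=; rewrite mulN1r.
by rewrite mulN1r.
Qed.

Lemma has_mean_sum P (I : Type) (r : seq I) (f : I -> T -> R) (a : I -> R) :
  (forall i, has_mean P (f i) (a i)) ->
  has_mean P (fun w => \sum_(i <- r) f i w) (\sum_(i <- r) a i).
Proof.
move=> h; elim: r => [|i r IH].
  by apply: eq_has_mean (has_mean_cst P 0) => [w|]; rewrite big_nil.
by apply: eq_has_mean (has_meanD (h i) IH) => [w|]; rewrite big_cons.
Qed.

Lemma ge0_has_mean P f a : measurable_fun setT f -> (forall w, 0 <= f w) ->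
  (\int[P]_w (f w)%:E = a%:E)%E -> has_mean P f a.
Proof.
move=> mf f0 Ef; split => //; apply/integrableP; split; first exact/measurable_EFinP.
rewrite (eq_integral (fun w => (f w)%:E)) ?Ef ?ltry// => w _.
by rewrite /= ger0_norm.
Qed.

Lemma le_has_mean P f g a b : (forall w, f w <= g w) ->
  has_mean P f a -> has_mean P g b -> a <= b.
Proof.
move=> fg [If Ef] [Ig Eg]; rewrite -lee_fin -Ef -Eg.
by apply: le_integral => // w _; rewrite lee_fin.
Qed.

Lemma integrable_has_mean P f : P.-integrable setT (EFin \o f) ->
  exists a, has_mean P f a.
Proof.
move=> If; exists (fine (\int[P]_w (f w)%:E)%E); split => //.
by rewrite fineK//; exact: integrable_fin_num If.
Qed.

Lemma dominated_has_mean P f g b : measurable_fun setT f ->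
  (forall w, `|f w| <= g w) -> has_mean P g b -> exists a, has_mean P f a.
Proof.
move=> mf fg [Ig _]; apply: integrable_has_mean.
apply: le_integrable Ig => //; first exact/measurable_EFinP.
by move=> w _ /=; rewrite lee_fin (le_trans (fg w))// ler_norm.
Qed.

End HasMean.

(** Change of variables: the pushforward of [P] by [Z] agrees with [Q] on measurable sets, so
    moments computed under the normal law carry over to random variables on [T1]. *)
Lemma has_mean_law (d1 d2 : measure_display) (T1 : measurableType d1)
    (T2 : measurableType d2) (R : realType) (P : probability T1 R)
    (Q : probability T2 R) (Z : T1 -> T2) (g : T2 -> R) (a : R) :
  measurable_fun setT Z ->
  (forall B, measurable B -> P (Z @^-1` B) = Q B) ->
  has_mean Q g a -> has_mean P (g \o Z) a.
Proof.
move=> mZ PQ hg; have mg := has_mean_measurable hg; case: hg => Ig Eg.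
have Igz : P.-integrable setT (EFin \o (g \o Z)).
  apply/integrableP; split.
    by apply/measurable_EFinP; exact: measurableT_comp.
  move/integrableP: Ig => [_]; apply: le_lt_trans.
  have m1 : measurable_fun setT (fun x => `|(g x)%:E|%E).
    by apply: measurableT_comp => //; exact/measurable_EFinP.
  rewrite (_ : (\int[Q]_x _)%E = \int[pushforward P Z]_x `|(g x)%:E|)%E; last first.
    by apply: eq_measure_integral => B mB _; apply/esym/PQ.
  by rewrite ge0_integral_pushforward//.
split=> //; rewrite -Eg.
transitivity (\int[pushforward P Z]_x (g x)%:E)%E; last first.
  by apply: eq_measure_integral => B mB _; exact: PQ.
rewrite integral_pushforward//; exact/measurable_EFinP.
Qed.

(** * Moments of Gaussian laws *)

Section Normal.
Context (R : realType).
Local Notation mu := (@lebesgue_measure R).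

(** The Radon-Nikodym derivative of the normal law equals [normal_pdf] almost everywhere, since both
    have the same integral over every measurable set. *)
Lemma ge0_integral_normal (m s : R) (f : R -> \bar R) :
  measurable_fun setT f -> (forall x, 0 <= f x)%E ->
  (\int[normal_prob m s]_x f x = \int[mu]_x (f x * (normal_pdf m s x)%:E))%E.
Proof.
move=> mf f0.
have dom := normal_prob_dominates m s.
rewrite -(Radon_Nikodym_SigmaFinite.change_of_variables dom)//.
have Ig := Radon_Nikodym_SigmaFinite.f_integrable dom.
have mp : measurable_fun setT (fun x => (normal_pdf m s x)%:E).
  by apply/measurable_EFinP; exact: measurable_normal_pdf.
apply: ae_eq_integral => //.
- by apply: emeasurable_funM => //; exact: measurable_int Ig.
- exact: emeasurable_funM.
- apply: ae_eqe_mul2l; apply: integral_ae_eq => // E _ mE.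
  by rewrite -Radon_Nikodym_SigmaFinite.f_integral.
Qed.

End Normal.

Section NormalMoments.
Context (R : realType).
Implicit Types (m s t r x : R).

(** Exponential tilting: a weight that turns one normal density into [c] times another has mean [c],
    because the new density has total mass 1. No integral needs to be computed. *)
Lemma has_mean_normal_tilt m s (f : R -> R) (c m' s' : R) :
  measurable_fun setT f -> (forall x, 0 <= f x) -> 0 <= c ->
  (forall x, f x * normal_pdf m s x = c * normal_pdf m' s' x) ->
  has_mean (normal_prob m s) f c.
Proof.
move=> mf f0 c0 fc; apply: ge0_has_mean => //.
rewrite ge0_integral_normal; [|exact/measurable_EFinP|by move=> x; rewrite lee_fin].
under eq_integral do rewrite -EFinM fc EFinM.
rewrite ge0_integralZl//.
- by rewrite integral_normal_pdf mule1.
- by apply/measurable_EFinP; exact: measurable_normal_pdf.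
- by move=> x _; rewrite lee_fin normal_pdf_ge0.
Qed.

Lemma normal_peakM s r : 0 < s -> 0 < r ->
  r * normal_peak (r * s) = normal_peak s.
Proof.
move=> s0 r0; rewrite /normal_peak exprMn -mulrA -mulrnAr sqrtrM ?sqr_ge0//.
by rewrite sqrtr_sqr gtr0_norm// invfM mulrA divff ?mul1r// gt_eqF.
Qed.

Lemma measurable_center m : measurable_fun [set: R] (fun x => x - m).
Proof. by apply: measurable_funB. Qed.

(** The coefficient is the one that turns the exponent [- z^2 / (2 s^2)] into [- z^2 / (2 (r s)^2)];
    the factor [r] is the ratio of the two peaks. *)
Lemma has_mean_expR_sqr m s r : 0 < s -> 0 < r ->
  has_mean (normal_prob m s)
    (fun x => expR ((1 - r ^- 2) / (2 * s ^+ 2) * (x - m) ^+ 2)) r.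
Proof.
move=> s0 r0; apply: (@has_mean_normal_tilt _ _ _ _ m (r * s)).
- apply: measurableT_comp => //; apply: measurable_funM => //.
  by apply: measurable_funX; exact: measurable_center.
- by move=> x; exact: expR_ge0.
- exact: ltW.
- move=> x; rewrite !normal_pdfE ?mulf_neq0 ?gt_eqF//.
  rewrite [RHS]mulrA normal_peakM// mulrCA; congr (_ * _).
  rewrite /normal_fun -expRD; congr expR.
  by rewrite -[_ *+ 2]mulr_natl -[X in _ = _ / X]mulr_natl; field; rewrite !gt_eqF.
Qed.

(** Completing the square: the tilt moves the mean by [t * s ^+ 2] and leaves the factor
    [exp (t^2 s^2 / 2)]. *)
Lemma has_mean_expR_center m s t : 0 < s ->
  has_mean (normal_prob m s) (fun x => expR (t * (x - m)))
    (expR (t ^+ 2 * s ^+ 2 / 2)).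
Proof.
move=> s0; apply: (@has_mean_normal_tilt _ _ _ _ (m + t * s ^+ 2) s).
- apply: measurableT_comp => //; apply: measurable_funM => //.
  exact: measurable_center.
- by move=> x; exact: expR_ge0.
- exact: expR_ge0.
- move=> x; rewrite !normal_pdfE ?gt_eqF//.
  rewrite mulrCA [RHS]mulrCA; congr (_ * _).
  rewrite /normal_fun -!expRD; congr expR.
  by rewrite -[_ *+ 2]mulr_natl; field; rewrite !gt_eqF.
Qed.

(* [1 + h z^2 <= exp (h z^2)] integrates to [1 + h M <= r], where [r] is the
   ratio of the standard deviations; [r ^+ 2 = M / s ^+ 2] forces [r = 1]. *)
Lemma normal_second_moment m s : 0 < s ->
  has_mean (normal_prob m s) (fun x => (x - m) ^+ 2) (s ^+ 2).
Proof.
move=> s0; have s2 : 0 < s ^+ 2 by rewrite exprn_gt0.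
have ms : measurable_fun [set: R] (fun x => (x - m) ^+ 2).
  by apply: measurable_funX; exact: measurable_center.
(* Any [r > 1] makes the coefficient in the exponent positive; [r = 2] gives an integrable
   exponential that dominates a positive multiple of the square. *)
have [M hM] : exists M, has_mean (normal_prob m s) (fun x => (x - m) ^+ 2) M.
  have h2 : 0 < (1 - 2 ^- 2) / (2 * s ^+ 2) :> R.
    by rewrite divr_gt0 ?mulr_gt0//; lra.
  have hE := has_meanZ ((1 - 2 ^- 2) / (2 * s ^+ 2))^-1
    (has_mean_expR_sqr m s0 (ltr0Sn R 1)).
  apply: (dominated_has_mean _ _ hE) => //.
  move=> x; rewrite ger0_norm ?sqr_ge0// mulrC ler_pdivlMr// mulrC.
  by apply: le_trans (expR_ge1Dx _); rewrite lerDr.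
have M0 : 0 <= M.
  by apply: le_has_mean (has_mean_cst _ 0) hM => x; exact: sqr_ge0.
have bnd r : 0 < r -> 1 + (1 - r ^- 2) / (2 * s ^+ 2) * M <= r.
  move=> r0; apply: le_has_mean (has_meanD (has_mean_cst _ 1)
    (has_meanZ _ hM)) (has_mean_expR_sqr m s0 r0).
  by move=> x; exact: expR_ge1Dx.
(* If [M] were 0, the bound at [r = 1/2] would read [1 <= 1/2]. *)
have {}M0 : 0 < M.
  rewrite lt_neqAle M0 andbT eq_sym; apply/negP => /eqP M00.
  by have := bnd (2^-1) ltac:(lra); rewrite M00 mulr0; lra.
suff -> : s ^+ 2 = M by [].
pose r := Num.sqrt M / s.
have r0 : 0 < r by rewrite divr_gt0// sqrtr_gt0.
have r2 : M = r ^+ 2 * s ^+ 2.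
  by rewrite /r expr_div_n sqr_sqrtr ?ltW// divfK// gt_eqF.
have : 1 + (r ^+ 2 - 1) / 2 <= r.
  have := bnd _ r0; rewrite r2.
  suff -> : (1 - r ^- 2) / (2 * s ^+ 2) * (r ^+ 2 * s ^+ 2) = (r ^+ 2 - 1) / 2 by [].
  by field; rewrite !gt_eqF.
move=> hr; have : (r - 1) ^+ 2 <= 0 by rewrite sqrrB expr1n mulr1; lra.
rewrite le_eqVlt ltNge sqr_ge0 orbF sqrf_eq0 subr_eq0 => /eqP r1.
by rewrite r2 r1 expr1n mul1r.
Qed.

(* [1 + t (x - m) <= exp (t (x - m))] integrates to
   [1 + t a <= exp (t^2 s^2 / 2)] for every [t]. *)
Lemma normal_first_moment m s : 0 < s ->
  has_mean (normal_prob m s) (fun x => x - m) 0.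
Proof.
move=> s0; have s2 : 0 < s ^+ 2 by rewrite exprn_gt0.
have [a ha] : exists a, has_mean (normal_prob m s) (fun x => x - m) a.
  have hE := has_meanD (has_mean_cst _ 1) (normal_second_moment m s0).
  apply: (dominated_has_mean _ _ hE); first exact: measurable_center.
  move=> x; set z := x - m; rewrite -real_normK ?num_real//.
  by have := sqr_ge0 (`|z| - 1); nra.
(* Multiplying [1 + t a <= exp u] by [1 - u], which is nonnegative and at most [exp (- u)], removes
   the exponential. *)
have bnd t : t ^+ 2 * s ^+ 2 / 2 <= 1 ->
    (1 + t * a) * (1 - t ^+ 2 * s ^+ 2 / 2) <= 1.
  set u := _ / 2; rewrite -subr_ge0 => p0.
  have h1 : 1 + t * a <= expR u.
    apply: le_has_mean (has_meanD (has_mean_cst _ 1) (has_meanZ t ha))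
      (has_mean_expR_center m t s0) => x.
    exact: expR_ge1Dx.
  apply: le_trans (ler_wpM2r p0 h1) _.
  apply: le_trans (ler_wpM2l (expR_ge0 u) (expR_ge1Dx (- u))) _.
  by rewrite -expRD subrr expR0.
suff -> : 0 = a by [].
(* At [t = a e] the bound becomes [a^2 e (1 - e s^2 / 2 - u) <= 0] with [u = (a e)^2 s^2 / 2]. This
   [e] is small enough to keep the bracket positive, which forces [a = 0]. *)
pose e := (1 + s ^+ 2 + a ^+ 2 * s ^+ 2)^-1.
have a2 : 0 <= a ^+ 2 by rewrite sqr_ge0.
have as0 : 0 <= a ^+ 2 * s ^+ 2 by rewrite mulr_ge0// ltW.
have d0 : 0 < 1 + s ^+ 2 + a ^+ 2 * s ^+ 2 by lra.
have e0 : 0 < e by rewrite invr_gt0.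
have eE : e * (1 + s ^+ 2 + a ^+ 2 * s ^+ 2) = 1 by rewrite mulVf// gt_eqF.
have e1 : e <= 1 by rewrite invf_le1//; lra.
have es0 : 0 <= e * s ^+ 2 by rewrite mulr_ge0// ltW.
have eas0 : 0 <= e * (a ^+ 2 * s ^+ 2) by rewrite mulr_ge0// ltW.
have eas1 : e * (e * (a ^+ 2 * s ^+ 2)) <= e * (a ^+ 2 * s ^+ 2).
  by rewrite ler_piMl.
have uE : (a * e) ^+ 2 * s ^+ 2 / 2 = e * (e * (a ^+ 2 * s ^+ 2)) / 2 by ring.
have esum : e + e * s ^+ 2 + e * (a ^+ 2 * s ^+ 2) = 1 by rewrite -eE; ring.
have := bnd (a * e); rewrite uE => /(_ ltac:(lra)) hb.
have : a ^+ 2 * e * (1 - e * s ^+ 2 / 2 - e * (e * (a ^+ 2 * s ^+ 2)) / 2) <= 0.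
  by rewrite -subr_ge0 in hb; rewrite -subr_ge0; move: hb; congr (0 <= _); ring.
rewrite pmulr_lle0; last by lra.
rewrite pmulr_lle0// => a20.
by apply/esym/eqP; rewrite -sqrf_eq0 eq_le a20 a2.
Qed.
End NormalMoments.

Section GaussianMoments.
Context (R : realType).

Lemma has_mean_dirac (a : R) (g : R -> R) :
  measurable_fun setT g -> has_mean \d_a g (g a).
Proof.
move=> mg; split.
  apply/integrableP; split; first exact/measurable_EFinP.
  rewrite integral_dirac//=; last first.
    by apply/measurable_EFinP; exact: measurableT_comp.
  by rewrite diracT mul1e ltry.
rewrite integral_dirac//= ?diracT ?mul1e//; exact/measurable_EFinP.
Qed.

Context (disp : measure_display) (T : measurableType disp).
Context (P : probability T R).

Lemma gauss_law_moments (f : T -> R) (a v : R) : 0 <= v ->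
  measurable_fun setT f ->
  (forall B, measurable B -> P (f @^-1` B) = gauss_law a v B) ->
  has_mean P f a /\ has_mean P (fun w => f w ^+ 2) (a ^+ 2 + v).
Proof.
move=> v0 mf; rewrite /gauss_law; have [->|vn0] := eqVneq v 0 => fP.
  have m2 : measurable_fun [set: R] (fun x => x ^+ 2) by [].
  rewrite addr0; split.
    exact: (has_mean_law mf fP (has_mean_dirac a (@measurable_id _ _ _))).
  exact: (has_mean_law mf fP (has_mean_dirac a m2)).
have s0 : 0 < Num.sqrt v by rewrite sqrtr_gt0 lt_neqAle eq_sym vn0.
have h1 := has_mean_law (Q := normal_prob a (Num.sqrt v)) mf fP
  (normal_first_moment a s0).
have := has_mean_law (Q := normal_prob a (Num.sqrt v)) mf fP (normal_second_moment a s0).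
rewrite sqr_sqrtr// => h2; split.
  by apply: eq_has_mean (has_meanD h1 (has_mean_cst P a)) => [w|] /=; ring.
apply: eq_has_mean (has_meanD (has_meanD h2 (has_meanZ (2 * a) h1))
  (has_mean_cst P (a ^+ 2))) => [w|] /=; ring.
Qed.

Lemma bilinear_delta (k : nat) (S : 'M[R]_k) (i j : 'I_k) :
  ((delta_mx i 0)^T *m S *m delta_mx j 0 : 'M[R]_1) 0 0 = S i j.
Proof. by rewrite trmx_delta -rowE -colE !mxE. Qed.

Context (k : nat) (Z : T -> 'cV[R]_k) (a : 'cV[R]_k) (S : 'M[R]_k).
Hypotheses (S_psd : sym_psd S) (gZ : gaussian_vector P Z a S).

Lemma gaussian_vector_form (t : 'cV[R]_k) :
  has_mean P (fun w => (t^T *m Z w) 0 0) ((t^T *m a) 0 0) /\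
  has_mean P (fun w => (t^T *m Z w) 0 0 ^+ 2)
    ((t^T *m a) 0 0 ^+ 2 + (t^T *m S *m t) 0 0).
Proof.
apply: gauss_law_moments; first exact: S_psd.2.
  under eq_fun do rewrite mxE.
  by apply: measurable_sum => i; apply: measurable_funM => //; exact: gZ.1.
exact: gZ.2.
Qed.

Lemma gaussian_vector_mean i : has_mean P (fun w => Z w i 0) (a i 0).
Proof.
have [h _] := gaussian_vector_form (delta_mx i 0).
by apply: eq_has_mean h => [w|]; rewrite trmx_delta -rowE mxE.
Qed.

(** Polarization: only laws of linear functionals are given, so the product is recovered from the
    squares of [Z_i + Z_j], [Z_i] and [Z_j]. Symmetry of [S] merges the two off-diagonal terms. *)
Lemma gaussian_vector_sqr_mean i j :
  has_mean P (fun w => Z w i 0 * Z w j 0) (a i 0 * a j 0 + S i j).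
Proof.
have [_ hD] := gaussian_vector_form (delta_mx i 0 + delta_mx j 0).
have [_ hi] := gaussian_vector_form (delta_mx i 0).
have [_ hj] := gaussian_vector_form (delta_mx j 0).
apply: eq_has_mean (has_meanZ 2^-1 (has_meanB hD (has_meanD hi hj))).
  by move=> w; rewrite linearD/= mulmxDl !trmx_delta -!rowE !mxE; field.
rewrite linearD/= !(mulmxDl, mulmxDr) ![((_ + _) : 'M[R]_1) 0 0]mxE !bilinear_delta.
rewrite !trmx_delta -!rowE ![row _ _ 0 0]mxE.
have -> : S j i = S i j by rewrite -[in LHS]S_psd.1 mxE.
by field.
Qed.

End GaussianMoments.

(** * Independence *)

Section Independence.
Context (disp : measure_display) (T : measurableType disp) (R : realType).
Context (P : probability T R).

(* The joint law of [(U, V)] is the product of the marginal laws. *)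
Lemma independent_tonelli (d1 d2 : measure_display) (T1 : measurableType d1)
    (T2 : measurableType d2) (U : T -> T1) (V : T -> T2)
    (mU : measurable_fun setT U) (mV : measurable_fun setT V)
    (h : T1 * T2 -> \bar R) :
  (forall B1 B2, measurable B1 -> measurable B2 ->
    P (U @^-1` B1 `&` V @^-1` B2) = (P (U @^-1` B1) * P (V @^-1` B2))%E) ->
  measurable_fun setT h -> (forall z, 0 <= h z)%E ->
  (\int[P]_w h (U w, V w) = \int[P]_w \int[P]_w' h (U w, V w'))%E.
Proof.
move=> ind mh h0.
have mUV : measurable_fun setT (fun w => (U w, V w)) by exact: measurable_fun_pair.
pose U' : {mfun T >-> T1} :=
  HB.pack_for {mfun T >-> T1} U (isMeasurableFun.Build _ _ _ _ U mU).
pose V' : {mfun T >-> T2} :=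
  HB.pack_for {mfun T >-> T2} V (isMeasurableFun.Build _ _ _ _ V mV).
pose UV' : {mfun T >-> (T1 * T2)%type} :=
  HB.pack_for {mfun T >-> (T1 * T2)%type} (fun w => (U w, V w))
    (isMeasurableFun.Build _ _ _ _ _ mUV).
pose m1 : probability T1 R := distribution P U'.
pose m2 : probability T2 R := distribution P V'.
pose m12 : probability (T1 * T2)%type R := distribution P UV'.
transitivity (\int[m12]_z h z)%E.
  by rewrite ge0_integral_pushforward.
transitivity (\int[(m1 \x m2)%E]_z h z)%E.
  apply: eq_measure_integral => B mB _; apply/esym.
  exact: product_measure_unique.
rewrite fubini_tonelli1//.
rewrite ge0_integral_pushforward//; last 2 first.
- exact: measurable_fun_fubini_tonelli_F.
- by move=> x _; apply: integral_ge0.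
apply: eq_integral => w _ /=; rewrite /fubini_F.
rewrite ge0_integral_pushforward//; exact: measurable_fun_pair2.
Qed.

(** Tonelli needs nonnegative factors, so the signed product is written with [p = |f| + f] and
    [q = |g| + g] as [f g = p q - p |g| - |f| q + |f| |g|]. *)
Lemma independent_has_meanM (f g : T -> R) (a b : R) :
  (forall B1 B2, measurable B1 -> measurable B2 ->
    P (f @^-1` B1 `&` g @^-1` B2) = (P (f @^-1` B1) * P (g @^-1` B2))%E) ->
  has_mean P f a -> has_mean P g b -> has_mean P (fun w => f w * g w) (a * b).
Proof.
move=> ind hf hg.
have mf := has_mean_measurable hf; have mg := has_mean_measurable hg.
have pos (p q : R -> R) (x y : R) : measurable_fun setT p -> measurable_fun setT q ->
    (forall z, 0 <= p z) -> (forall z, 0 <= q z) ->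
    has_mean P (p \o f) x -> has_mean P (q \o g) y ->
    has_mean P (fun w => p (f w) * q (g w)) (x * y).
  move=> mp mq p0 q0 hp hq; apply: ge0_has_mean.
  - by apply: measurable_funM; exact: measurableT_comp.
  - by move=> w; rewrite mulr_ge0.
  rewrite (independent_tonelli mf mg (h := fun z => (p z.1 * q z.2)%:E))//.
  - rewrite mulrC -(has_meanZ y hp).2; apply: eq_integral => w _ /=.
    by rewrite (has_meanZ _ hq).2 mulrC.
  - apply/measurable_EFinP; apply: measurable_funM.
      exact: (measurableT_comp mp measurable_fst).
    exact: (measurableT_comp mq measurable_snd).
  - by move=> z; rewrite lee_fin mulr_ge0.
have [a' ha'] := integrable_has_mean (integrable_norm hf.1).
have [b' hb'] := integrable_has_mean (integrable_norm hg.1).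
have mn : measurable_fun [set: R] (fun x : R => `|x|) by exact: normr_measurable.
have mp : measurable_fun [set: R] (fun x : R => `|x| + x).
  exact: measurable_funD.
have p0 (z : R) : 0 <= `|z| + z.
  by rewrite -lerBlDr sub0r -normrN ler_norm.
have hfp := has_meanD ha' hf; have hgp := has_meanD hb' hg.
have n0 (z : R) : 0 <= `|z| by [].
have H1 := pos _ _ _ _ mp mp p0 p0 hfp hgp.
have H2 := pos _ _ _ _ mp mn p0 n0 hfp hb'.
have H3 := pos _ _ _ _ mn mp n0 p0 ha' hgp.
have H4 := pos _ _ _ _ mn mn n0 n0 ha' hb'.
by apply: eq_has_mean (has_meanD (has_meanB (has_meanB H1 H2) H3) H4)
  => [w|] /=; ring.
Qed.

End Independence.

(** * Least squares *)

Section SquaredNorm.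
Context (R : realType).

Lemma sqnormE (p q : nat) (M : 'M[R]_(p, q)) :
  sqnorm M = \sum_i \sum_j M i j ^+ 2.
Proof.
rewrite /sqnorm /mxtrace exchange_big; apply: eq_bigr => j _.
by rewrite mxE; apply: eq_bigr => i _; rewrite mxE expr2.
Qed.

Lemma sqnorm_ge0 (p q : nat) (M : 'M[R]_(p, q)) : 0 <= sqnorm M.
Proof.
by rewrite sqnormE; apply: sumr_ge0 => i _; apply: sumr_ge0 => j _; exact: sqr_ge0.
Qed.

Lemma sqnorm_eq0 (p q : nat) (M : 'M[R]_(p, q)) : (sqnorm M == 0) = (M == 0).
Proof.
apply/eqP/eqP => [|->]; last first.
  by rewrite sqnormE big1// => i _; rewrite big1// => j _; rewrite mxE expr0n.
rewrite sqnormE => /eqP; rewrite psumr_eq0; last first.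
  by move=> i _; apply: sumr_ge0 => j _; exact: sqr_ge0.
move=> /allP h; apply/matrixP => i j; rewrite mxE.
have /implyP/(_ isT) := h i (mem_index_enum i).
rewrite psumr_eq0; last by move=> ? _; exact: sqr_ge0.
by move=> /allP/(_ j (mem_index_enum j))/implyP/(_ isT); rewrite sqrf_eq0 => /eqP.
Qed.

Lemma sqnormN (p q : nat) (M : 'M[R]_(p, q)) : sqnorm (- M) = sqnorm M.
Proof. by rewrite /sqnorm [(- M)^T]linearN mulmxN mulNmx opprK. Qed.

Lemma sqnormD (p q : nat) (M N : 'M[R]_(p, q)) :
  sqnorm (M + N) = sqnorm M + sqnorm N + 2 * \tr (M^T *m N).
Proof.
rewrite /sqnorm [(M + N)^T]linearD/= mulmxDl !mulmxDr !raddfD/=.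
have -> : \tr (N^T *m M) = \tr (M^T *m N).
  by rewrite -mxtrace_tr trmx_mul trmxK.
by ring.
Qed.

Lemma sqnormB_le (p q : nat) (M N : 'M[R]_(p, q)) :
  sqnorm (M - N) <= 2 * (sqnorm M + sqnorm N).
Proof.
have := sqnorm_ge0 (M + N); rewrite !sqnormD sqnormN mulmxN raddfN/=; lra.
Qed.

(** A vector [u] killed by the Gram matrix satisfies [|M u|^2 = u^T M^T M u = 0], so the Gram matrix
    and [M] have the same kernel. *)
Lemma gram_unitP (p q : nat) (M : 'M[R]_(p, q)) :
  (M^T *m M \in unitmx) <-> (forall u : 'cV[R]_q, M *m u = 0 -> u = 0).
Proof.
split=> [Mu u Mu0|inj].
  by rewrite -[u]mul1mx -(mulVmx Mu) -!mulmxA Mu0 !mulmx0.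
rewrite -row_free_unit -kermx_eq0; apply/eqP/row_matrixP => i; rewrite row0.
set v := row i _; have vG : v *m (M^T *m M) = 0.
  by rewrite -row_mul mulmx_ker row0.
suff : v^T = 0 by move=> /(congr1 trmx); rewrite trmxK trmx0.
apply: inj; apply/eqP; rewrite -sqnorm_eq0 /sqnorm trmx_mul trmxK.
by rewrite -mulmxA mulmxA mulmxA -(mulmxA v) vG mul0mx mxtrace0.
Qed.

Lemma trmx_invgram (p q : nat) (M : 'M[R]_(p, q)) :
  (invmx (M^T *m M))^T = invmx (M^T *m M).
Proof. by rewrite trmx_inv trmx_mul trmxK. Qed.

Lemma trmx_oproj (p q : nat) (M : 'M[R]_(p, q)) : (oproj M)^T = oproj M.
Proof. by rewrite /oproj !trmx_mul trmxK trmx_invgram mulmxA. Qed.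

End SquaredNorm.

Section Projection.
Context (R : realType) (p q : nat) (M : 'M[R]_(p, q)).
Hypothesis Mu : M^T *m M \in unitmx.

Lemma oprojK : oproj M *m M = M.
Proof. by rewrite /oproj -!mulmxA mulVmx// mulmx1. Qed.

Lemma oproj_idem : oproj M *m oproj M = oproj M.
Proof. by rewrite {2 3}/oproj !mulmxA oprojK. Qed.

Lemma trace_oproj : \tr (oproj M) = q%:R.
Proof. by rewrite /oproj -mulmxA mxtrace_mulC -mulmxA mulVmx// mxtrace1. Qed.

Lemma sqnorm_oproj : sqnorm (oproj M) = q%:R.
Proof. by rewrite /sqnorm trmx_oproj oproj_idem trace_oproj. Qed.

Lemma oproj_resid : oproj M *m (1%:M - oproj M) = 0.
Proof. by rewrite mulmxBr mulmx1 oproj_idem subrr. Qed.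

Lemma trmx_resid : (1%:M - oproj M)^T = 1%:M - oproj M.
Proof. by rewrite linearB/= trmx1 trmx_oproj. Qed.

Lemma resid_idem :
  (1%:M - oproj M) *m (1%:M - oproj M) = 1%:M - oproj M.
Proof. by rewrite mulmxBl mul1mx oproj_resid subr0. Qed.

Lemma resid_mul : (1%:M - oproj M) *m M = 0.
Proof. by rewrite mulmxBl mul1mx oprojK subrr. Qed.

End Projection.

(** * Joint least squares and partialling out (Frisch-Waugh-Lovell) *)

Section JointLeastSquares.
Context (R : realType) (n d m : nat) (X : 'M[R]_(n, d)) (A : 'M[R]_(n, m)).

Lemma joint_gram_unitP :
  ((row_mx X A)^T *m row_mx X A \in unitmx) <->
  (forall (u : 'cV[R]_d) (v : 'cV[R]_m), X *m u + A *m v = 0 -> u = 0 /\ v = 0).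
Proof.
rewrite gram_unitP; split=> [inj u v h|inj w].
  have /eqP : col_mx u v = 0 by apply: inj; rewrite mul_row_col.
  by rewrite col_mx_eq0 => /andP[/eqP -> /eqP ->].
by rewrite -(vsubmxK w) mul_row_col => /inj[-> ->]; rewrite col_mx0.
Qed.

Hypothesis XAu : (row_mx X A)^T *m row_mx X A \in unitmx.

Lemma gram_left_unit : X^T *m X \in unitmx.
Proof.
apply/gram_unitP => u Xu.
by case: ((joint_gram_unitP.1 XAu) u 0 _) => //; rewrite Xu mulmx0 addr0.
Qed.

(** If the residual of [A v] vanishes, then [A v] lies in the column space of [X], and joint
    independence of the columns gives [v = 0]. *)
Lemma gram_oresid_unit : (oresid X A)^T *m oresid X A \in unitmx.
Proof.
apply/gram_unitP => v; rewrite /oresid mulmxBl mul1mx mulmxBl => /eqP.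
rewrite subr_eq0 => /eqP Av.
case: ((joint_gram_unitP.1 XAu) (- (invmx (X^T *m X) *m X^T *m A *m v)) v) => //.
by rewrite mulmxN Av /oproj !mulmxA addNr.
Qed.

(** Frisch-Waugh-Lovell: multiplying the equation for the residual [r] on the left by the transpose
    of [oresid X A] kills [r] and [X w] and turns [A v] into the Gram matrix of [oresid X A] times
    [v]. Several columns are allowed so that [e] can be the identity. *)
Lemma oresid_coefficient (k : nat) (e : 'M[R]_(n, k)) (w : 'M[R]_(d, k))
    (v : 'M[R]_(m, k)) :
  X^T *m (e - X *m w - A *m v) = 0 -> A^T *m (e - X *m w - A *m v) = 0 ->
  v = lpinv (oresid X A) *m e.
Proof.
set r := e - _ - _ => Xr Ar.
have Au := gram_oresid_unit; have Xu := gram_left_unit.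
have NAr : (oresid X A)^T *m r = 0.
  rewrite /oresid trmx_mul trmx_resid -mulmxA mulmxBl mul1mx mulmxBr Ar.
  by rewrite /oproj -!mulmxA Xr !mulmx0 subrr.
have NX : (oresid X A)^T *m X = 0.
  by rewrite /oresid trmx_mul trmx_resid -mulmxA resid_mul// mulmx0.
have NA : (oresid X A)^T *m A = (oresid X A)^T *m oresid X A.
  by rewrite /oresid trmx_mul trmx_resid -!mulmxA; congr (_ *m _);
    rewrite mulmxA resid_idem.
have : (oresid X A)^T *m e = (oresid X A)^T *m oresid X A *m v.
  move: NAr; rewrite /r -NA; set B := (oresid X A)^T in NX *.
  by rewrite !mulmxBr !mulmxA NX mul0mx subr0 => /eqP; rewrite subr_eq0 => /eqP.
by move=> Ee; rewrite /lpinv -[RHS]mulmxA Ee mulKmx.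
Qed.

Lemma joint_normal_solution (k : nat) (e : 'M[R]_(n, k)) :
  exists w v, X^T *m (e - X *m w - A *m v) = 0 /\
              A^T *m (e - X *m w - A *m v) = 0.
Proof.
pose b := invmx ((row_mx X A)^T *m row_mx X A) *m (row_mx X A)^T *m e.
exists (usubmx b), (dsubmx b).
have : (row_mx X A)^T *m (e - row_mx X A *m b) = 0.
  by rewrite mulmxBr /b !mulmxA mulmxV// mul1mx subrr.
rewrite -[X in row_mx _ _ *m X]vsubmxK mul_row_col opprD addrA tr_row_mx mul_col_mx.
by move=> /eqP; rewrite col_mx_eq0 => /andP[/eqP -> /eqP ->].
Qed.

End JointLeastSquares.

Lemma joint_gram_unitC (R : realType) (n d m : nat) (X : 'M[R]_(n, d))
    (A : 'M[R]_(n, m)) :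
  (row_mx X A)^T *m row_mx X A \in unitmx ->
  (row_mx A X)^T *m row_mx A X \in unitmx.
Proof.
move=> /joint_gram_unitP h; apply/joint_gram_unitP => u v.
by rewrite addrC => /h[-> ->].
Qed.

Section NormalEquations.
Context (R : realType) (n d m : nat) (X : 'M[R]_(n, d)) (A : 'M[R]_(n, m)).
Hypothesis XAu : (row_mx X A)^T *m row_mx X A \in unitmx.
Local Notation H := (lpinv (oresid A X)).
Local Notation G := (lpinv (oresid X A)).

(** A solution exists, and partialling out, once in each order of the two blocks, forces its
    coefficients to be [H *m e] and [G *m e]. *)
Lemma lpinv_normal_equations (k : nat) (e : 'M[R]_(n, k)) :
  X^T *m (e - X *m (H *m e) - A *m (G *m e)) = 0 /\
  A^T *m (e - X *m (H *m e) - A *m (G *m e)) = 0.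
Proof.
have [w [v [hX hA]]] := joint_normal_solution XAu e.
suff [<- <-] : w = H *m e /\ v = G *m e by [].
split; last exact: oresid_coefficient hX hA.
by apply: (oresid_coefficient (joint_gram_unitC XAu) (v := w) (w := v));
  rewrite addrAC.
Qed.

(** The first normal equation at [e = I] reads [X^T X H = X^T (I - A G)]; this eliminates [H] in
    favour of [G]. *)
Lemma oblique_projE : X *m H = oproj X *m (1%:M - A *m G).
Proof.
have [+ _] := lpinv_normal_equations (1%:M : 'M[R]_n).
rewrite !mulmx1 addrAC mulmxBr => /eqP; rewrite subr_eq0 => /eqP XE.
by rewrite /oproj -!mulmxA XE (mulmxA X^T) mulKmx// (gram_left_unit XAu).
Qed.

(** The rows of [G] are combinations of the columns of [oresid X A], which are orthogonal to the
    range of [X]. *)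
Lemma lpinv_oresid_oproj : G *m oproj X = 0.
Proof.
suff GX : (oresid X A)^T *m oproj X = 0 by rewrite /lpinv -[LHS]mulmxA GX mulmx0.
rewrite /oresid trmx_mul trmx_resid -mulmxA mulmxBl mul1mx.
by rewrite oproj_idem ?subrr ?mulmx0// (gram_left_unit XAu).
Qed.

End NormalEquations.

(** * The least-squares minimizer *)

Section Minimizer.
Context (R : realType) (n d m : nat) (X : 'M[R]_(n, d)) (A : 'M[R]_(n, m)).
Context (y : 'cV[R]_n).

(** Pythagoras: the normal equations make the residual orthogonal to every change of fit, and a
    nonzero change of coefficients changes the fit because the columns are independent. *)
Lemma ls_minimizerE (w : 'cV[R]_d) (v : 'cV[R]_m) :
  (row_mx X A)^T *m row_mx X A \in unitmx ->
  X^T *m (y - X *m w - A *m v) = 0 -> A^T *m (y - X *m w - A *m v) = 0 ->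
  ls_minimizer X A y = (w, v).
Proof.
move=> /joint_gram_unitP inj hX hA.
have strict b' : b' <> (w, v) -> ls_objective X A y (w, v) < ls_objective X A y b'.
  case: b' => w' v' /= ne; rewrite /ls_objective/= ltr_pM2l ?invr_gt0//.
  set r := y - X *m w - A *m v in hX hA *.
  have -> : y - X *m w' - A *m v' = r + (X *m (w - w') + A *m (v - v')).
    rewrite !mulmxBr /r; apply/matrixP => i j; rewrite !mxE; ring.
  rewrite sqnormD mulmxDr !mulmxA.
  have -> : r^T *m X = 0 by rewrite -[r^T *m X]trmxK trmx_mul trmxK hX trmx0.
  have -> : r^T *m A = 0 by rewrite -[r^T *m A]trmxK trmx_mul trmxK hA trmx0.
  rewrite !mul0mx addr0 mxtrace0 mulr0 addr0 ltrDl lt_neqAle sqnorm_ge0 andbT.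
  rewrite eq_sym sqnorm_eq0; apply/eqP => /inj[/eqP + /eqP +].
  by rewrite !subr_eq0 => /eqP ew /eqP ev; apply: ne; rewrite ew ev.
apply: xget_unique => // b hb; apply: contrapT => ne.
have := hb (w, v) (fun e => ne (esym e)); have := strict b ne.
by move=> h1 h2; have := lt_trans h1 h2; rewrite ltxx.
Qed.

(** Shifting a minimizer along a kernel vector keeps the objective, so no strict minimizer exists
    and the default is returned. This makes the predictor explicit on the exceptional event, for use
    in proving the risk measurable. *)
Lemma ls_minimizer_singular :
  (row_mx X A)^T *m row_mx X A \notin unitmx -> ls_minimizer X A y = (0, 0).
Proof.
move=> sing; apply: xgetPN => -[w v] hb; move/negP: sing; apply.
apply/joint_gram_unitP => u1 u2 h; apply: contrapT => ne.
have /hb : (w + u1, v + u2) <> (w, v).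
  by move=> [e1 e2]; apply: ne; split; [apply: (addrI w)|apply: (addrI v)];
    rewrite addr0.
rewrite /ls_objective/= !mulmxDr.
have -> : y - (X *m w + X *m u1) - (A *m v + A *m u2)
    = y - X *m w - A *m v - (X *m u1 + A *m u2).
  apply/matrixP => i j; rewrite !mxE; ring.
by rewrite h subr0 ltxx.
Qed.

End Minimizer.

(** * The PI predictor and its noise matrix [K] *)

Section PiPredictor.
Context (R : realType) (n d m : nat) (X : 'M[R]_(n, d)) (A : 'M[R]_(n, m)).
Context (mu : 'cV[R]_d -> 'cV[R]_m).

(** Adding [X w + A v] to the targets [e] translates the least-squares solution by [(w, v)]. *)
Lemma tau_piE (w : 'cV[R]_d) (v : 'cV[R]_m) (e : 'cV[R]_n) :
  (row_mx X A)^T *m row_mx X A \in unitmx ->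
  tau_pi X mu A (X *m w + A *m v + e) =
  X *m w + mu_mx X mu *m v + K_mx X mu A *m e.
Proof.
move=> XAu; have [hX hA] := lpinv_normal_equations XAu e.
rewrite /tau_pi (@ls_minimizerE _ _ _ _ _ _ _
  (w + lpinv (oresid A X) *m e) (v + lpinv (oresid X A) *m e) XAu).
- rewrite /= /K_mx !mulmxDr mulmxDl !mulmxA.
  by apply/matrixP => i j; rewrite !mxE; ring.
- rewrite -[RHS]hX; congr (_ *m _).
  by rewrite !mulmxDr; apply/matrixP => i j; rewrite !mxE; ring.
- rewrite -[RHS]hA; congr (_ *m _).
  by rewrite !mulmxDr; apply/matrixP => i j; rewrite !mxE; ring.
Qed.

Lemma K_mxE : (row_mx X A)^T *m row_mx X A \in unitmx ->
  K_mx X mu A =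
  oproj X - (oproj X *m A - mu_mx X mu) *m lpinv (oresid X A).
Proof.
move=> XAu; rewrite /K_mx oblique_projE// mulmxBr mulmx1 mulmxBl !mulmxA.
by rewrite opprB addrA addrAC.
Qed.

(** Cyclicity of the trace brings [G] next to [oproj X] in the cross term, which therefore
    vanishes. *)
Lemma sqnorm_K_mx : (row_mx X A)^T *m row_mx X A \in unitmx ->
  sqnorm (K_mx X mu A) = d%:R +
  sqnorm ((oproj X *m A - mu_mx X mu) *m lpinv (oresid X A)).
Proof.
move=> XAu; have Xu := gram_left_unit XAu.
rewrite K_mxE// sqnormD sqnormN sqnorm_oproj// trmx_oproj mulmxN raddfN/=.
rewrite mxtrace_mulC -[_ *m _ *m oproj X]mulmxA lpinv_oresid_oproj//.
by rewrite mulmx0 mxtrace0 oppr0 mulr0 addr0.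
Qed.

End PiPredictor.

(** For a single column [a], [L = lpinv a] has [L L^T = (a^T a)^-1], a 1 by 1 matrix, which factors
    out of the trace. *)
Lemma sqnorm_mul_lpinv (R : realType) (n p : nat) (C : 'M[R]_(p, 1))
    (a : 'M[R]_(n, 1)) : a^T *m a \in unitmx ->
  sqnorm (C *m lpinv a) = sqnorm C / sqnorm a.
Proof.
move=> au; have LL : lpinv a *m (lpinv a)^T = invmx (a^T *m a).
  by rewrite /lpinv trmx_mul trmxK trmx_invgram mulmxA -(mulmxA _ a^T) mulVmx ?mul1mx.
rewrite /sqnorm; set L := lpinv a in LL *; move: L LL => L LL.
rewrite trmx_mul mxtrace_mulC !mulmxA -(mulmxA _ L) LL.
rewrite mxtrace_mulC mulmxA !trace_mx11.
have /(congr1 (fun M : 'M[R]_1 => M 0 0)) := mulmxV au.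
move: (a^T *m a) (C^T *m C) => B S.
rewrite !mxE !big_ord1 /= => BV.
have B0 : B 0 0 != 0.
  by apply/eqP => B0; move: BV; rewrite B0 mul0r => /eqP; rewrite eq_sym oner_eq0.
by apply: (mulfI B0); rewrite mulrCA BV mulr1 mulrCA divff ?mulr1.
Qed.

(** The factor 2 comes from [|M - N|^2 <= 2 (|M|^2 + |N|^2)], applied to [oproj X *m A] and
    [mu_mx X mu]. *)
Lemma sqnorm_K_mx_le (R : realType) (n d : nat) (X : 'M[R]_(n, d))
    (A : 'M[R]_(n, 1)) (mu : 'cV[R]_d -> 'cV[R]_1) :
  (row_mx X A)^T *m row_mx X A \in unitmx ->
  sqnorm (K_mx X mu A) <= d%:R + 2 * ((sqnorm (oproj X *m A) + sqnorm (mu_mx X mu))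
    / sqnorm ((1%:M - oproj X) *m A)).
Proof.
move=> XAu; rewrite sqnorm_K_mx// sqnorm_mul_lpinv; last exact: gram_oresid_unit.
by rewrite lerD2l mulrA ler_wpM2r ?sqnormB_le// invr_ge0 sqnorm_ge0.
Qed.

(** * Random matrices *)

Section MeasurableMatrix.
Context (disp : measure_display) (T : measurableType disp) (R : realType).

(* Written as [x * (x^2)^(-1)] so as to reduce to real powers; [0^-1 = 0]. *)
Lemma measurable_invr : measurable_fun [set: R] (fun x : R => x^-1).
Proof.
rewrite (_ : (fun x => _) = (fun x : R => x * (x ^+ 2) `^ (-1))).
  apply: measurable_funM => //.
  by apply: (measurableT_comp (f := fun y : R => y `^ (-1))) => //;
    exact: measurable_powR.
apply/funext => x; rewrite powR_inv1 ?sqr_ge0//.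
by have [->|x0] := eqVneq x 0; rewrite ?invr0 ?mul0r//; field.
Qed.

Definition measurable_mx (p q : nat) (M : T -> 'M[R]_(p, q)) :=
  forall i j, measurable_fun setT (fun w => M w i j).

Lemma measurable_mx_cst (p q : nat) (M : 'M[R]_(p, q)) :
  measurable_mx (fun=> M).
Proof. by move=> i j; exact: measurable_cst. Qed.

Lemma measurable_mx_tr (p q : nat) (M : T -> 'M[R]_(p, q)) :
  measurable_mx M -> measurable_mx (fun w => (M w)^T).
Proof. by move=> h i j; under eq_fun do rewrite mxE; exact: h. Qed.

Lemma measurable_mxM (p q r : nat) (M : T -> 'M[R]_(p, q))
    (N : T -> 'M[R]_(q, r)) :
  measurable_mx M -> measurable_mx N -> measurable_mx (fun w => M w *m N w).
Proof.
move=> hM hN i j; under eq_fun do rewrite mxE.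
by apply: measurable_sum => k; apply: measurable_funM.
Qed.

Lemma measurable_mxD (p q : nat) (M N : T -> 'M[R]_(p, q)) :
  measurable_mx M -> measurable_mx N -> measurable_mx (fun w => M w + N w).
Proof.
move=> hM hN i j; under eq_fun do rewrite mxE.
exact: measurable_funD.
Qed.

Lemma measurable_mxB (p q : nat) (M N : T -> 'M[R]_(p, q)) :
  measurable_mx M -> measurable_mx N -> measurable_mx (fun w => M w - N w).
Proof.
move=> hM hN i j; under eq_fun do rewrite !mxE.
exact: measurable_funB.
Qed.

Lemma measurable_row_mx (p q r : nat) (M : T -> 'M[R]_(p, q))
    (N : T -> 'M[R]_(p, r)) :
  measurable_mx M -> measurable_mx N -> measurable_mx (fun w => row_mx (M w) (N w)).
Proof.
move=> hM hN i j; under eq_fun do rewrite mxE.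
by case: (fintype.split j) => k; [exact: hM|exact: hN].
Qed.

Lemma measurable_det (p : nat) (M : T -> 'M[R]_p) :
  measurable_mx M -> measurable_fun setT (fun w => \det (M w)).
Proof.
move=> hM; rewrite /determinant; apply: measurable_sum => s.
apply: measurable_funM => //; apply: measurable_prod => i _; exact: hM.
Qed.

Lemma measurable_unitmx (p : nat) (M : T -> 'M[R]_p) :
  measurable_mx M -> measurable_fun setT (fun w => M w \in unitmx).
Proof.
move=> hM; under eq_fun do rewrite unitmxE unitfE.
apply: measurable_neg; apply: measurable_fun_eqr => //; exact: measurable_det.
Qed.

Lemma measurable_invmx (p : nat) (M : T -> 'M[R]_p) :
  measurable_mx M -> measurable_mx (fun w => invmx (M w)).
Proof.
move=> hM i j.
(* Cramer's rule; [invmx] returns a singular matrix unchanged, whence the second branch. *)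
have -> : (fun w => invmx (M w) i j) = (fun w => if M w \in unitmx then
    (\det (M w))^-1 * cofactor (M w) j i else M w i j).
  by apply/funext => w; rewrite /invmx; case: ifP => // _; rewrite !mxE.
apply: measurable_fun_ifT; [exact: measurable_unitmx| |exact: hM].
apply: measurable_funM.
  by apply: (measurableT_comp measurable_invr); exact: measurable_det.
rewrite /cofactor; apply: measurable_funM => //; apply: measurable_det => k l.
by under eq_fun do rewrite !mxE; exact: hM.
Qed.

Lemma measurable_oproj (p q : nat) (M : T -> 'M[R]_(p, q)) :
  measurable_mx M -> measurable_mx (fun w => oproj (M w)).
Proof.
move=> hM; apply: measurable_mxM; last exact: measurable_mx_tr.
apply: measurable_mxM => //; apply: measurable_invmx.
by apply: measurable_mxM => //; exact: measurable_mx_tr.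
Qed.

Lemma measurable_lpinv (p q : nat) (M : T -> 'M[R]_(p, q)) :
  measurable_mx M -> measurable_mx (fun w => lpinv (M w)).
Proof.
move=> hM; apply: measurable_mxM; last exact: measurable_mx_tr.
apply: measurable_invmx.
by apply: measurable_mxM => //; exact: measurable_mx_tr.
Qed.

Lemma measurable_oresid (p q r : nat) (N : T -> 'M[R]_(p, q))
    (M : T -> 'M[R]_(p, r)) :
  measurable_mx N -> measurable_mx M -> measurable_mx (fun w => oresid (N w) (M w)).
Proof.
move=> hN hM; apply: measurable_mxM => //; apply: measurable_mxB.
  exact: measurable_mx_cst.
exact: measurable_oproj.
Qed.

Lemma measurable_K_mx (n d m : nat) (X : 'M[R]_(n, d))
    (mu : 'cV[R]_d -> 'cV[R]_m) (A : T -> 'M[R]_(n, m)) :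
  measurable_mx A -> measurable_mx (fun w => K_mx X mu (A w)).
Proof.
move=> hA; have hX := measurable_mx_cst X.
have hm := measurable_mx_cst (mu_mx X mu).
apply: measurable_mxD; apply: measurable_mxM => //;
  apply: measurable_lpinv; exact: measurable_oresid.
Qed.

Lemma measurable_sqnorm (p q : nat) (M : T -> 'M[R]_(p, q)) :
  measurable_mx M -> measurable_fun setT (fun w => sqnorm (M w)).
Proof.
move=> hM; under eq_fun do rewrite sqnormE.
apply: measurable_sum => i; apply: measurable_sum => j.
by apply: measurable_funX; exact: hM.
Qed.

End MeasurableMatrix.

(** * Mean squared norm of an affine image of a centred vector *)

Section QuadraticMean.
Context (disp : measure_display) (T : measurableType disp) (R : realType).
Context (P : probability T R) (n : nat) (Z : T -> 'cV[R]_n) (S : 'M[R]_n).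
Hypothesis mean_Z : forall i, has_mean P (fun w => Z w i 0) 0.
Hypothesis cov_Z : forall i j, has_mean P (fun w => Z w i 0 * Z w j 0) (S i j).

Lemma has_mean_sqnorm_affine (p : nat) (c : 'cV[R]_p) (M : 'M[R]_(p, n)) :
  has_mean P (fun w => sqnorm (c + M *m Z w))
    (sqnorm c + \tr (M *m S *m M^T)).
Proof.
(* Mean of the squared [i]-th coordinate, expanded into constant, linear and quadratic parts; the
   linear part has mean 0. *)
have h i := has_meanD (has_meanD (has_mean_cst P (c i 0 ^+ 2))
  (has_meanZ (2 * c i 0) (has_mean_sum (index_enum 'I_n)
     (fun k => has_meanZ (M i k) (mean_Z k)))))
  (has_mean_sum (index_enum 'I_n) (fun k => has_mean_sum (index_enum 'I_n)
     (fun l => has_meanZ (M i k * M i l) (cov_Z k l)))).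
apply: eq_has_mean (has_mean_sum (index_enum 'I_p) h).
  move=> w /=; rewrite sqnormE; apply: eq_bigr => i _.
  rewrite big_ord1 !mxE sqrrD; congr (_ + _ + _).
    by rewrite -mulrA mulr_natl.
  rewrite expr2 big_distrl; apply: eq_bigr => k _ /=.
  by rewrite big_distrr; apply: eq_bigr => l _ /=; ring.
rewrite sqnormE /mxtrace -big_split; apply: eq_bigr => i _ /=.
rewrite big_ord1 [X in _ * X]big1 ?mulr0 ?addr0; last first.
  by move=> k _; rewrite mulr0.
congr (_ + _); rewrite exchange_big mxE; apply: eq_bigr => l _.
rewrite mxE big_distrl; apply: eq_bigr => k _ /=.
by rewrite mxE; ring.
Qed.

End QuadraticMean.

(** * Expected risks *)

Section SigmaMx.
Context (disp : measure_display) (T : measurableType disp) (R : realType).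
Context (p q : nat) (Z : T -> 'M[R]_(p, q)).

(* The measurable sets of this type are, by conversion, those of [sigma_mx Z]. *)
Definition sigma_mx_type := g_sigma_algebraType
  (\bigcup_(ij in [set: 'I_p * 'I_q])
     preimage_set_system setT (fun w => Z w ij.1 ij.2) measurable).

Lemma measurable_mx_sigma : measurable_mx (Z : sigma_mx_type -> 'M[R]_(p, q)).
Proof.
move=> i j _ B mB; apply: sub_sigma_algebra; exists (i, j) => //=.
by exists B.
Qed.

(** The identity into [sigma_mx_type] becomes a random element whose events are exactly those of
    [sigma_mx Z], the form in which independence is assumed. *)
Lemma measurable_id_sigma : measurable_mx Z ->
  measurable_fun setT (id : T -> sigma_mx_type).
Proof.
move=> mZ _ B sB; rewrite setTI; move: B sB.
apply: smallest_sub; first exact: sigma_algebra_measurable.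
by move=> _ [[i j] _ [B mB <-]]; exact: mZ.
Qed.

Lemma sigma_mx_preimage (f : sigma_mx_type -> R) (B : set R) :
  measurable_fun setT f -> measurable B -> sigma_mx Z (f @^-1` B).
Proof. by move=> mf mB; rewrite -[_ @^-1` _]setTI; exact: mf. Qed.

End SigmaMx.

Section Model.
Context (R : realType) (disp : measure_display) (T : measurableType disp).
Context (P : probability T R) (n d m : nat).
Context (X : 'M[R]_(n, d)) (mu : 'cV[R]_d -> 'cV[R]_m).
Context (Sigma : 'cV[R]_d -> 'M[R]_m) (sigma : R).
Context (wstar : 'cV[R]_d) (vstar : 'cV[R]_m).
Context (A : T -> 'M[R]_(n, m)) (eps : T -> 'cV[R]_n).
Hypothesis Sigma_psd : forall x, sym_psd (Sigma x).
Hypothesis model : pi_model P X mu Sigma sigma A eps.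
Local Notation muX := (mu_mx X mu).
Local Notation Lambda := (Lambda_mx X Sigma vstar).

Lemma pi_model_measurable_A : measurable_mx A.
Proof.
case: model => gA _ _ _ i j; have [h _] := gA i.
by have := h j; under eq_fun do rewrite !mxE.
Qed.

Lemma pi_model_measurable_eps : measurable_mx eps.
Proof. by case: model => _ _ [h _] _ i j; rewrite ord1. Qed.

Lemma scalar_psd : sym_psd ((sigma ^+ 2)%:M : 'M[R]_n).
Proof.
split=> [|z]; first exact: tr_scalar_mx.
by rewrite mul_mx_scalar -scalemxAl mxE mulr_ge0 ?sqr_ge0//
  -trace_mx11 sqnorm_ge0.
Qed.

Lemma has_mean_eps i : has_mean P (fun w => eps w i 0) 0.
Proof.
case: model => _ _ geps _.
by have := gaussian_vector_mean scalar_psd geps i; rewrite mxE.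
Qed.

Lemma has_mean_eps2 i j : has_mean P (fun w => eps w i 0 * eps w j 0)
  ((sigma ^+ 2)%:M i j).
Proof.
case: model => _ _ geps _.
have := gaussian_vector_sqr_mean scalar_psd geps i j.
by rewrite mxE mul0r add0r.
Qed.

(** The [i]-th entry of [A vstar] is the linear functional [vstar] of the Gaussian row [a_i], and
    its variance is the [i]-th diagonal entry of [Lambda]. *)
Lemma has_mean_Av i :
  has_mean P (fun w => (A w *m vstar) i 0) ((muX *m vstar) i 0) /\
  has_mean P (fun w => (A w *m vstar) i 0 ^+ 2)
    ((muX *m vstar) i 0 ^+ 2 + Lambda i i).
Proof.
case: model => gA _ _ _.
have [h1 h2] := gaussian_vector_form (Sigma_psd _) (gA i) vstar.
have E (w : T) : (vstar^T *m (row i (A w))^T) 0 0 = (A w *m vstar) i 0.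
  by rewrite -trmx_mul mxE -row_mul mxE.
have Em : (vstar^T *m mu (design_pt X i)) 0 0 = (muX *m vstar) i 0.
  by rewrite !mxE; apply: eq_bigr => j _; rewrite !mxE mulrC.
split; first by apply: eq_has_mean h1 => [w|].
apply: eq_has_mean h2 => [w|]; first by rewrite E.
by rewrite Em; congr (_ + _); rewrite !mxE eqxx mulr1n.
Qed.

Lemma has_mean_Av_cross i j : i != j ->
  has_mean P (fun w => (A w *m vstar) i 0 * (A w *m vstar) j 0)
    ((muX *m vstar) i 0 * (muX *m vstar) j 0).
Proof.
move=> ij; apply: independent_has_meanM; last 2 first.
- by case: (has_mean_Av i).
- by case: (has_mean_Av j).
case: model => _ ind _ _ B1 B2 mB1 mB2.
(* Mutual independence is applied to the index set [{i, j}] only, so the value of [E] at any other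
   index is arbitrary. *)
pose E k := if k == i then (fun w => (A w *m vstar) i 0) @^-1` B1
            else (fun w => (A w *m vstar) j 0) @^-1` B2.
have sig k B : measurable B -> sigma_mx (fun w => row k (A w))
    ((fun w => (A w *m vstar) k 0) @^-1` B).
  move=> mB; have -> : (fun w => (A w *m vstar) k 0) =
      (fun w => (row k (A w) *m vstar) 0 0).
    by apply/funext => w; rewrite -row_mul [RHS]mxE.
  apply: sigma_mx_preimage => //.
  apply: measurable_mxM; first exact: measurable_mx_sigma.
  exact: measurable_mx_cst.
have := ind [set i; j]%SET E.
have -> : \bigcap_(k in [set k | k \in [set i; j]%SET]) E k =
    (fun w => (A w *m vstar) i 0) @^-1` B1 `&` (fun w => (A w *m vstar) j 0) @^-1` B2.
  apply/seteqP; split=> [w h|w [h1 h2] k /=].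
    split; first by have := h i; rewrite /E eqxx; apply; rewrite /= !inE eqxx.
    have := h j; rewrite /E eq_sym (negbTE ij); apply.
    by rewrite /= !inE eqxx orbT.
  by rewrite !inE => /orP[]/eqP->; rewrite /E ?eqxx// eq_sym (negbTE ij).
move=> ->; last first.
  move=> k; rewrite !inE /E => /orP[]/eqP->; rewrite ?eqxx; first exact: sig.
  by rewrite eq_sym (negbTE ij); exact: sig.
by rewrite big_setU1 ?inE//= big_set1 /E eqxx eq_sym (negbTE ij).
Qed.

Lemma has_mean_Av_eps i j :
  has_mean P (fun w => (A w *m vstar) i 0 * eps w j 0) 0.
Proof.
apply: (eq_has_mean (f := fun w => (A w *m vstar) i 0 * eps w j 0)
  (a := (muX *m vstar) i 0 * 0)) => //; first by rewrite mulr0.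
apply: independent_has_meanM; last 2 first.
- by case: (has_mean_Av i).
- exact: has_mean_eps.
case: model => _ _ _ ind B1 B2 mB1 mB2; apply: ind.
  apply: sigma_mx_preimage => //.
  apply: measurable_mxM; first exact: measurable_mx_sigma.
  exact: measurable_mx_cst.
by apply: sigma_mx_preimage => //; exact: measurable_mx_sigma.
Qed.

Let noise w : 'cV[R]_n := A w *m vstar - muX *m vstar + eps w.
Let S : 'M[R]_n := Lambda + (sigma ^+ 2)%:M.

Lemma has_mean_noise i : has_mean P (fun w => noise w i 0) 0.
Proof.
apply: eq_has_mean (has_meanD (has_meanB (has_mean_Av i).1
  (has_mean_cst P ((muX *m vstar) i 0))) (has_mean_eps i)) => [w|].
  by rewrite !mxE.
by rewrite subrr addr0.
Qed.

Lemma has_mean_noise2 i j : has_mean P (fun w => noise w i 0 * noise w j 0) (S i j).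
Proof.
set u := fun w => (A w *m vstar) i 0; set v := fun w => (A w *m vstar) j 0.
set a := (muX *m vstar) i 0; set b := (muX *m vstar) j 0.
have huv : has_mean P (fun w => u w * v w) (a * b + Lambda i j).
  have [ij|ij] := eqVneq i j.
    rewrite /u /v /a /b -ij; apply: eq_has_mean (has_mean_Av i).2 => [w|];
      by rewrite expr2.
  apply: eq_has_mean (has_mean_Av_cross ij) => [w //|].
  by rewrite [Lambda i j]mxE (negbTE ij) mulr0n addr0.
have hu : has_mean P u a := (has_mean_Av i).1.
have hv : has_mean P v b := (has_mean_Av j).1.
have hue := has_mean_Av_eps i j; have hve := has_mean_Av_eps j i.
(* Expansion of [(u - a + eps_i) (v - b + eps_j)]: [H1] is the part free of [eps], up to the
   constant [a b], and [H2] collects the mixed terms, of mean 0. *)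
have H1 := has_meanB (has_meanB huv (has_meanZ b hu)) (has_meanZ a hv).
have H2 := has_meanD (has_meanB hue (has_meanZ a (has_mean_eps j)))
  (has_meanB hve (has_meanZ b (has_mean_eps i))).
apply: eq_has_mean (has_meanD (has_meanD H1 H2)
  (has_meanD (has_mean_cst P (a * b)) (has_mean_eps2 i j))) => [w|].
  have E k : noise w k 0 = (A w *m vstar) k 0 - (muX *m vstar) k 0 + eps w k 0.
    by rewrite /noise 2!mxE; congr (_ + _ + _); rewrite mxE.
  by rewrite !E -/(u w) -/(v w) -/a -/b; ring.
by rewrite /S [RHS]mxE; ring.
Qed.

(** The fresh target minus [t] is the fixed vector [X wstar + muX vstar - t] plus the centred noise,
    so bias and variance separate. *)
Lemma riskE (t : 'cV[R]_n) : risk P X wstar vstar A eps t =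
  (n%:R^-1 * (sqnorm (X *m wstar + muX *m vstar - t) + \tr S))%:E.
Proof.
rewrite /risk unlock.
have := has_meanZ n%:R^-1 (has_mean_sqnorm_affine has_mean_noise has_mean_noise2
  (X *m wstar + muX *m vstar - t) 1%:M).
rewrite mul1mx trmx1 mulmx1 => -[_ <-]; apply: eq_integral => w _.
congr (_ * sqnorm _)%:E; rewrite mul1mx /noise /target.
by apply/matrixP => i j; rewrite !mxE; ring.
Qed.

Hypothesis X_inv : X^T *m X \in unitmx.

Lemma expected_risk_nopi :
  expected_risk P X wstar vstar A eps
    (fun w => tau_nopi X (target X wstar vstar A eps w)) =
  (n%:R^-1 * (sqnorm ((1%:M - oproj X) *m muX *m vstar) +
     (\tr (oproj X *m Lambda) + sigma ^+ 2 * d%:R) + \tr S))%:E.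
Proof.
rewrite /expected_risk; under eq_integral do rewrite riskE.
(* The mean target minus the OLS prediction is [(I - oproj X) muX vstar - oproj X z], where [z] is
   the training noise. *)
have := has_meanZ n%:R^-1 (has_meanD (has_mean_sqnorm_affine has_mean_noise
  has_mean_noise2 ((1%:M - oproj X) *m muX *m vstar) (- oproj X))
  (has_mean_cst P (\tr S))).
have -> : \tr (- oproj X *m S *m (- oproj X)^T) =
    \tr (oproj X *m Lambda) + sigma ^+ 2 * d%:R.
  rewrite [(- oproj X)^T]linearN/= trmx_oproj mulNmx mulNmx mulmxN opprK.
  rewrite mxtrace_mulC mulmxA oproj_idem// mulmxDr mxtraceD mul_mx_scalar.
  by rewrite mxtraceZ trace_oproj.
move=> -[_ <-]; apply: eq_integral => w _; congr (_ * (sqnorm _ + _))%:E.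
rewrite /tau_nopi /target /noise mulNmx !mulmxDr mulmxN !mulmxBl mul1mx !mulmxA.
rewrite -/(oproj X) oprojK//.
by apply/matrixP => i j; rewrite !mxE; ring.
Qed.

(* Conditioning on [A]: the inner integral over [eps] is [sigma^2 |K(A)|^2]. *)
Lemma integral_sqnorm_K_eps :
  (\int[P]_w (sqnorm (K_mx X mu (A w) *m eps w))%:E =
   (sigma ^+ 2)%:E * \int[P]_w (sqnorm (K_mx X mu (A w)))%:E)%E.
Proof.
have mA := pi_model_measurable_A; have me := pi_model_measurable_eps.
have sA := measurable_mx_sigma (Z := A).
have se := measurable_mx_sigma (Z := eps).
pose h (z : sigma_mx_type A * sigma_mx_type eps) : \bar R :=
  (sqnorm (K_mx X mu (A z.1) *m eps z.2))%:E.
(* Both random elements are the identity of [T], seen in the sigma-algebras of [A] and [eps]; the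
   product formula required is then the independence of [A] and [eps] itself. *)
rewrite (independent_tonelli (measurable_id_sigma mA) (measurable_id_sigma me)
  (h := h)).
- rewrite -ge0_integralZl//; last 3 first.
  + apply/measurable_EFinP; apply: measurable_sqnorm; exact: measurable_K_mx.
  + by move=> w _; rewrite lee_fin sqnorm_ge0.
  + by rewrite lee_fin sqr_ge0.
  apply: eq_integral => w _; rewrite /h /=.
  have := has_mean_sqnorm_affine has_mean_eps has_mean_eps2 0 (K_mx X mu (A w)).
  move=> -[_]; under eq_integral do rewrite add0r.
  move=> ->; rewrite -EFinM; congr (_%:E).
  rewrite mul_mx_scalar -scalemxAl mxtraceZ mxtrace_mulC.
  have /eqP -> : sqnorm (0 : 'cV[R]_n) == 0 by rewrite sqnorm_eq0.
  by rewrite add0r.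
- by case: model.
- apply/measurable_EFinP; apply: measurable_sqnorm; apply: measurable_mxM.
    apply: measurable_K_mx => i j.
    exact: (measurableT_comp (sA i j) measurable_fst).
  by move=> i j; exact: (measurableT_comp (se i j) measurable_snd).
- by move=> z; rewrite lee_fin sqnorm_ge0.
Qed.

Lemma trace_S_ge0 : 0 <= \tr S.
Proof.
rewrite /S /mxtrace; apply: sumr_ge0 => i _; rewrite mxE addr_ge0//.
  by rewrite /Lambda_mx mxE eqxx mulr1n mxE; exact: (Sigma_psd _).2.
by rewrite mxE eqxx mulr1n sqr_ge0.
Qed.

Hypothesis XA_inv : {ae P, forall w,
  (row_mx X (A w))^T *m row_mx X (A w) \in unitmx}.

(** The mean of [|K|^2] may be infinite, so the identity holds in the extended reals and is derived
    with nonnegative integrals only. *)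
Lemma expected_risk_pi :
  expected_risk P X wstar vstar A eps
    (fun w => tau_pi X mu (A w) (target X wstar vstar A eps w)) =
  ((n%:R^-1 * \tr S)%:E +
    (sigma ^+ 2 / n%:R)%:E * \int[P]_w (sqnorm (K_mx X mu (A w)))%:E)%E.
Proof.
have mA := pi_model_measurable_A; have me := pi_model_measurable_eps.
have n0 : 0 <= n%:R^-1 :> R by rewrite invr_ge0.
have mKe : measurable_fun setT (fun w => sqnorm (K_mx X mu (A w) *m eps w)).
  apply: measurable_sqnorm; apply: measurable_mxM; last exact: me.
  exact: measurable_K_mx.
have mg : measurable_fun setT (fun w => (row_mx X (A w))^T *m row_mx X (A w) \in unitmx).
  apply: measurable_unitmx; apply: measurable_mxM; first apply: measurable_mx_tr;
  by apply: measurable_row_mx => //; exact: measurable_mx_cst.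
pose f w := n%:R^-1 * (sqnorm (K_mx X mu (A w) *m eps w) + \tr S).
have mf : measurable_fun setT f.
  by apply: measurable_funM => //; apply: measurable_funD.
rewrite /expected_risk; under eq_integral do rewrite riskE.
transitivity (\int[P]_w (f w)%:E)%E.
  apply: ge0_ae_eq_integral => //.
  (* Measurability is required at every point: where the joint Gram matrix is singular the
     prediction is 0, so the integrand is a measurable function defined by two cases. *)
  - have -> : (fun w => (n%:R^-1 * (sqnorm (X *m wstar + muX *m vstar -
        tau_pi X mu (A w) (target X wstar vstar A eps w)) + \tr S))%:E) =
      (fun w => (if (row_mx X (A w))^T *m row_mx X (A w) \in unitmx then f w else
        n%:R^-1 * (sqnorm (X *m wstar + muX *m vstar) + \tr S))%:E).
      apply/funext => w; congr (_%:E); case: ifPn => [u|s].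
        rewrite /target tau_piE// /f; congr (_ * (_ + _)).
        by rewrite opprD addrA subrr sub0r sqnormN.
      by rewrite /tau_pi ls_minimizer_singular//= !mulmx0 addr0 subr0.
    by apply/measurable_EFinP; apply: measurable_fun_ifT.
  - exact/measurable_EFinP.
  - by move=> w _; rewrite lee_fin mulr_ge0 ?addr_ge0 ?sqnorm_ge0 ?trace_S_ge0.
  - by move=> w _; rewrite lee_fin mulr_ge0 ?addr_ge0 ?sqnorm_ge0 ?trace_S_ge0.
  - apply: filterS XA_inv => w u _; rewrite /target tau_piE// /f; congr (_ * (_ + _))%:E.
    by rewrite opprD addrA subrr sub0r sqnormN.
under eq_integral do rewrite EFinM EFinD.
rewrite ge0_integralZl//; last 2 first.
- by apply: emeasurable_funD => //; exact/measurable_EFinP.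
- by move=> w _; rewrite adde_ge0 ?lee_fin ?sqnorm_ge0 ?trace_S_ge0.
rewrite ge0_integralD//; last 3 first.
- by move=> w _; rewrite lee_fin sqnorm_ge0.
- exact/measurable_EFinP.
- by move=> w _; rewrite lee_fin trace_S_ge0.
rewrite integral_sqnorm_K_eps integral_cst//= probability_setT mule1.
rewrite ge0_muleDr ?lee_fin ?trace_S_ge0//; last first.
  by rewrite mule_ge0 ?lee_fin ?sqr_ge0//; apply: integral_ge0 => w _;
    rewrite lee_fin sqnorm_ge0.
by rewrite addeC muleA -!EFinM [X in (X%:E * _)%E]mulrC.
Qed.

End Model.

(** * Comparison of the two expected risks *)

Theorem propositionI1 (R : realType)
  (disp : measure_display) (T : measurableType disp) (P : probability T R)
  (n d m : nat) (n_gt0 : (0 < n)%N) (d_gt0 : (0 < d)%N) (m_gt0 : (0 < m)%N)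
  (sigma : R) (sigma_gt0 : 0 < sigma)
  (wstar : 'cV[R]_d) (vstar : 'cV[R]_m)
  (mu : 'cV[R]_d -> 'cV[R]_m) (Sigma : 'cV[R]_d -> 'M[R]_m)
  (Sigma_psd : forall x, sym_psd (Sigma x))
  (X : 'M[R]_(n, d))
  (A : T -> 'M[R]_(n, m)) (eps : T -> 'cV[R]_n)
  (model : pi_model P X mu Sigma sigma A eps)
  (X_inv : X^T *m X \in unitmx)
  (A_inv : {ae P, forall w, (A w)^T *m A w \in unitmx})
  (XA_inv : {ae P, forall w,
     (row_mx X (A w))^T *m row_mx X (A w) \in unitmx}) :
  let y := target X wstar vstar A eps in
  let ER := expected_risk P X wstar vstar A eps in
  let ER_nopi := ER (fun w => tau_nopi X (y w)) in
  let ER_pi := ER (fun w => tau_pi X mu (A w) (y w)) in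
  let muX := mu_mx X mu in
  let Lambda := Lambda_mx X Sigma vstar in
  let Pix := oproj X in
  ((ER_nopi > ER_pi)%E <->
   ((n%:R^-1 * sqnorm ((1%:M - Pix) *m muX *m vstar)
     + sigma ^+ 2 * d%:R / n%:R + n%:R^-1 * \tr (Pix *m Lambda))%:E
    > (sigma ^+ 2 / n%:R)%:E * 'E_P[fun w => sqnorm (K_mx X mu (A w))])%E)
  /\
  (m = 1%N ->
   ((n%:R^-1 * sqnorm ((1%:M - Pix) *m muX *m vstar)
     + n%:R^-1 * \tr (Pix *m Lambda))%:E
    > (2 * sigma ^+ 2 / n%:R)%:E
      * 'E_P[fun w => ((sqnorm (Pix *m A w) + sqnorm muX)
                       / sqnorm ((1%:M - Pix) *m A w))%R]
      + (sigma ^+ 2 * d%:R / n%:R)%:E)%E ->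
   (ER_nopi > ER_pi)%E).
Proof.
move=> y ER ER_nopi ER_pi muX Lambda Pix.
have mA := pi_model_measurable_A model.
have iffE : (ER_nopi > ER_pi)%E <->
   ((n%:R^-1 * sqnorm ((1%:M - Pix) *m muX *m vstar)
     + sigma ^+ 2 * d%:R / n%:R + n%:R^-1 * \tr (Pix *m Lambda))%:E
    > (sigma ^+ 2 / n%:R)%:E * 'E_P[fun w => sqnorm (K_mx X mu (A w))])%E.
  rewrite /ER_nopi /ER_pi /ER /y.
  rewrite (expected_risk_nopi wstar vstar Sigma_psd model X_inv).
  rewrite (expected_risk_pi wstar vstar Sigma_psd model XA_inv) unlock.
  rewrite /Pix /muX /Lambda; set t := \tr (_ + _).
  set x := (_ + _ * _ / _ + _).
  (* The common term [t / n] is a finite real, so it cancels even when the mean of [|K|^2] is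
     infinite. *)
  rewrite (_ : n%:R^-1 * (_ + _ + t) = n%:R^-1 * t + x); last by rewrite /x; ring.
  by rewrite EFinD lteD2lE.
(* The left side of the criterion exceeds that of [hyp] by [sigma^2 d / n >= 0], so it suffices to
   bound the [K] term by the right side of [hyp]. *)
split=> // m1; subst m => hyp; apply/iffE; apply: le_lt_trans; last first.
  apply: lt_le_trans hyp _; rewrite lee_fin.
  by rewrite lerD2r lerDl mulr_ge0 ?invr_ge0// mulr_ge0// sqr_ge0.
rewrite unlock; pose q w := (sqnorm (Pix *m A w) + sqnorm muX) /
  sqnorm ((1%:M - Pix) *m A w).
have mq : measurable_fun setT q.
  apply: measurable_funM.
    apply: measurable_funD => //; apply: measurable_sqnorm.
    by apply: measurable_mxM => //; exact: measurable_mx_cst.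
  apply: (measurableT_comp (@measurable_invr R)); apply: measurable_sqnorm.
  by apply: measurable_mxM => //; exact: measurable_mx_cst.
have q0 w : 0 <= q w by rewrite divr_ge0 ?addr_ge0 ?sqnorm_ge0.
(* The almost sure bound [|K|^2 <= d + 2 q] is integrated; its constant [d] yields the term
   [sigma^2 d / n] on the right of [hyp]. *)
apply: (@le_trans _ _ ((sigma ^+ 2 / n%:R)%:E *
    \int[P]_w (d%:R + 2 * q w)%:E)%E).
  apply: lee_wpmul2l; first by rewrite lee_fin divr_ge0// sqr_ge0.
  apply: ae_ge0_le_integral => //.
  - by move=> w _; rewrite lee_fin sqnorm_ge0.
  - apply/measurable_EFinP; apply: measurable_sqnorm; exact: measurable_K_mx.
  - by move=> w _; rewrite lee_fin addr_ge0// mulr_ge0.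
  - by apply/measurable_EFinP; apply: measurable_funD => //; exact: measurable_funM.
  - by apply: filterS XA_inv => w u _; rewrite lee_fin; exact: sqnorm_K_mx_le.
have Iq0 : (0 <= \int[P]_w (q w)%:E)%E.
  by apply: integral_ge0 => w _; rewrite lee_fin.
under eq_integral do rewrite EFinD EFinM.
rewrite ge0_integralD//; last 2 first.
- by move=> w _; rewrite mule_ge0// lee_fin.
- by apply: measurable_funeM; exact/measurable_EFinP.
rewrite ge0_integralZl//; last 2 first.
- exact/measurable_EFinP.
- by move=> w _; rewrite lee_fin.
rewrite integral_cst//= probability_setT mule1 ge0_muleDr//; last by rewrite mule_ge0.
rewrite muleA -!EFinM addeC.
have -> : sigma ^+ 2 / n%:R * 2 = 2 * sigma ^+ 2 / n%:R by ring.
have -> : sigma ^+ 2 / n%:R * d%:R = sigma ^+ 2 * d%:R / n%:R by ring.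
exact: lexx.
Qed.
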